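(* For all $\tau=(\tau_\ell)_{\ell\in\mathcal L}$ with $\tau_\ell\ge0$ and all $\overline\mu\in\mathcal A$, $$\mathcal I_{\mathrm{cur}}^*(\overline\mu)\ \le\ \mathcal I_{\mathrm{tmp},\tau}^{(LB)}(\overline\mu)\ \le\ \mathcal I_{\mathrm{tmp},\tau}^*(\overline\mu),$$ and, for all $\tau$ with $\tau_\ell\ge0$, $$\tilde{\mathcal R}^{(\mathrm{cur})}_{\epsilon,p}\subseteq\tilde{\mathcal R}^{(\mathrm{tmp},\tau,LB)}_{\epsilon,p}\subseteq\tilde{\mathcal R}^{(\mathrm{tmp},\tau)}_{\epsilon,p}.$$
   Context: Network. $\mathcal G=(\mathcal N,\mathcal L)$ is a finite connected graph with nodes $\{0,1,\dots,N\}$, arbitrarily oriented edges (lines) $\ell\in\mathcal L$ and weights $w_\ell>0$. $A\in\mathbb R^{|\mathcal L|\times(N+1)}$ is the incidence matrix ($A_{\ell,i}=1$ if $\ell=(i,j)$, $-1$ if $\ell=(j,i)$, $0$ otherwise), $W=\mathrm{diag}(w_\ell)$, $B=A^\top WA$, $\hat B$ is $B$ with the row and column of node $0$ deleted, $\breve B=\begin{pmatrix}0&0\\0&\hat B^{-1}\end{pmatrix}$, $\Lambda=\mathrm{diag}(1/I_{\ell,\max})$ with constants $I_{\ell,\max}>0$, and $\overline C=\Lambda WA\breve B$. Fix $1\le m\le N$; $C$ consists of columns $1,\dots,m$ of $\overline C$ and $C_D$ of columns $m+1,\dots,N$. For $\overline\mu=(\mu,\mu_D)\in\mathbb R^m\times\mathbb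 R^{N-m}=\mathbb R^N$ put $y=C_D\mu_D$ and $\nu=C\mu+y$. $C_\ell$ is the $\ell$-th row of $C$ and $\mathcal L'=\{\ell\in\mathcal L: C_\ell\ne0\}$. Admissible initial conditions. $\mathcal A=\{\overline\mu\in\mathbb R^N: |\nu_\ell|\le1 \text{ for all } \ell\in\mathcal L,\ |\nu_\ell|<1\text{ for all }\ell\notin\mathcal L'\}$. Rate function. $T>0$. For each $\mu\in\mathbb R^m$ (the functions may depend on $\mu$) there are given, for $i=1,\dots,m$, a drift $b_i:\mathbb R\to\mathbb R$, Lipschitz and differentiable with $b_i(\mu_i)=0$, and a diffusion coefficient $l_i:\mathbb R\to(0,\infty)$, Lipschitz, bounded and differentiable. $H^1_\mu$ is the set of $g:[0,T]\to\mathbb R^m$ with $g(t)=\mu+\int_0^t\phi(s)\,ds$, $\phi\in L_2([0,T])$. For $g\in H^1_\mu$, $\mathcal I_{\mathrm{pow}}(g)=\sum_{i=1}^m\frac12\int_0^T\left(\frac{g_i'-b_i(g_i)}{l_i(g_i)}\right)^2dt$. For continuous $f:[0,T]\to\mathbb R^{|\mathcal L|}$, $\|f\|_\infty=\max_{t\in[0,T]}\max_\ell|f_\ell(t)|$. Temperature map. For a continuous $f:[0,T]\to\mathbb R^{|\mathcal L|}$ with $f(0)=\nu$, $\xi_\tau(f)_\ell(t)=\nu_\ell^2e^{-t/\tau_\ell}+\frac1{\tau_\ell}\int_0^te^{-(t-s)/\tau_\ell}f_\ell(s)^2ds$ if $\tau_\ell>0$, and $\xi_\tau(f)_\ell(t)=f_\ell(t)^2$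 if $\tau_\ell=0$. Decay rates (infimum over the empty set is $+\infty$). $\mathcal I_{\mathrm{cur}}^*(\overline\mu)=\inf\{\mathcal I_{\mathrm{pow}}(g): g\in H^1_\mu,\ \|y+Cg\|_\infty\ge1\}$. $\mathcal I_{\mathrm{tmp},\tau}^*(\overline\mu)=\inf\{\mathcal I_{\mathrm{pow}}(g): g\in H^1_\mu,\ \|\xi_\tau(y+Cg)\|_\infty\ge1\}$. For $\ell\in\mathcal L'$ and $a\in\mathbb R$, $\psi_\ell^{(a)}=\inf\{\mathcal I_{\mathrm{pow}}(g): g\in H^1_\mu,\ y_\ell+C_\ell g(T)=a\}$. $\alpha_\ell=\sqrt{\frac{1-\nu_\ell^2e^{-T/\tau_\ell}}{1-e^{-T/\tau_\ell}}}$, with $e^{-T/\tau_\ell}:=0$ (so $\alpha_\ell=1$) if $\tau_\ell=0$. $\mathcal I_{\mathrm{tmp},\tau}^{(LB)}(\overline\mu)=\min_{\ell\in\mathcal L'}\min\{\psi_\ell^{(\alpha_\ell)},\psi_\ell^{(-\alpha_\ell)}\}$. Regions. For $\epsilon>0$ and $p\in(0,1)$, $\tilde{\mathcal R}^{(\mathrm{cur})}_{\epsilon,p}$, $\tilde{\mathcal R}^{(\mathrm{tmp},\tau,LB)}_{\epsilon,p}$ and $\tilde{\mathcal R}^{(\mathrm{tmp},\tau)}_{\epsilon,p}$ are the sets of $\overline\mu\in\mathcal A$ for which, respectively, $\mathcal I_{\mathrm{cur}}^*(\overline\mu)$, $\mathcal I_{\mathrm{tmp},\tau}^{(LB)}(\overline\mu)$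 and $\mathcal I_{\mathrm{tmp},\tau}^*(\overline\mu)$ is $\ge-\epsilon\log p$. *)

(* Defs.v *)
(* MathComp / MathComp-Analysis *)
From HB Require Import structures.
From mathcomp Require Import all_boot all_order all_algebra.
From mathcomp Require Import all_classical all_reals all_analysis.
Set Implicit Arguments.
Unset Strict Implicit.
Unset Printing Implicit Defensive.
Import Order.TTheory GRing.Theory Num.Theory.
Import numFieldNormedType.Exports.
Local Open Scope classical_set_scope.
Local Open Scope ring_scope.

(* A connected graph on the nodes 0, ..., N, given by its set of lines, i.e.
   edges with an arbitrary orientation. [lines_oriented] says that every edge
   carries exactly one orientation (and, taking i = j, excludes loops). *)
Record network (R : realType) (N : nat) := Network {
  lines : {set 'I_(1 + N) * 'I_(1 + N)} ;
  lines_oriented : forall i j, (i, j) \in lines -> (j, i) \notin lines ;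
  lines_connected : forall i j,
    connect (fun i j => ((i, j) \in lines) || ((j, i) \in lines)) i j ;
  weight : 'I_#|lines| -> R ;
  weight_gt0 : forall l, 0 < weight l ;
  Imax : 'I_#|lines| -> R ;
  Imax_gt0 : forall l, 0 < Imax l
}.

(* Drifts and diffusion coefficients; both families may depend on the initial
   point mu. *)
Record dynamics (R : realType) (m : nat) := Dynamics {
  drift : 'cV[R]_m -> 'I_m -> R -> R ;
  drift_lipschitz : forall mu i, lipschitz (drift mu i) ;
  drift_derivable : forall mu i x, derivable (drift mu i) x 1 ;
  drift_init : forall (mu : 'cV[R]_m) i, drift mu i (mu i 0) = 0 ;
  diffusion : 'cV[R]_m -> 'I_m -> R -> R ;
  diffusion_gt0 : forall mu i x, 0 < diffusion mu i x ;
  diffusion_lipschitz : forall mu i, lipschitz (diffusion mu i) ;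
  diffusion_bounded : forall mu i, bounded_fun (diffusion mu i) ;
  diffusion_derivable : forall mu i x, derivable (diffusion mu i) x 1
}.

Section Network.
Variables (R : realType) (N : nat) (G : network R N).
Local Notation L := #|lines G|.

Definition incidence : 'M[R]_(L, 1 + N) :=
  \matrix_(l, i) (if i == (enum_val l).1 then 1
                  else if i == (enum_val l).2 then -1 else 0).

Definition weight_mx : 'M[R]_L := diag_mx (\row_l weight l).

Definition laplacian : 'M[R]_(1 + N) :=
  incidence^T *m weight_mx *m incidence.

(* B with the row and column of node 0 deleted *)
Definition reduced_laplacian : 'M[R]_N := drsubmx laplacian.

Definition laplacian_breve : 'M[R]_(1 + N) :=
  block_mx 0 0 0 (invmx reduced_laplacian).

Definition Lambda_mx : 'M[R]_L := diag_mx (\row_l (Imax l)^-1).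

Definition Cbar : 'M[R]_(L, 1 + N) :=
  Lambda_mx *m weight_mx *m incidence *m laplacian_breve.

End Network.

(* The columns of Cbar are indexed by the nodes 0, ..., N with N = m + d:
   column 0 is dropped, nodes 1, ..., m are stochastic and nodes
   m + 1, ..., m + d are deterministic. *)
Section Injections.
Variables (R : realType) (m d : nat) (G : network R (m + d)).
Local Notation L := #|lines G|.

Definition C_mx : 'M[R]_(L, m) := lsubmx (rsubmx (Cbar G)).
Definition CD_mx : 'M[R]_(L, d) := rsubmx (rsubmx (Cbar G)).

Definition yvec (mubar : 'cV[R]_(m + d)) : 'cV[R]_L :=
  CD_mx *m dsubmx mubar.
Definition nuvec (mubar : 'cV[R]_(m + d)) : 'cV[R]_L :=
  C_mx *m usubmx mubar + yvec mubar.

Definition stochastic_lines : {set 'I_L} := [set l | row l C_mx != 0].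

Definition admissible : set 'cV[R]_(m + d) :=
  [set mubar | (forall l, `|nuvec mubar l 0| <= 1) /\
    (forall l, l \notin stochastic_lines -> `|nuvec mubar l 0| < 1)].

End Injections.

(* Paths on [0, T] are functions on R of which only the values on [0, T]
   matter. *)
Section Paths.
Variables (R : realType) (T : R).
Local Notation leb := (@lebesgue_measure R).

Definition L2 (f : R -> R) : Prop := f \_ `[0, T] \in Lfun leb 2%:E.

Definition H1 m (mu : 'cV[R]_m) : set (R -> 'cV[R]_m) :=
  [set g : R -> 'cV[R]_m | exists phi : R -> 'cV[R]_m,
    (forall i, L2 (fun s : R => phi s i 0)) /\
    (forall t : R, t \in `[0, T] -> forall i,
      g t i 0 = mu i 0 + \int[leb]_(s in `[0, t]) phi s i 0)].

(* For g in H1 mu the derivative exists almost everywhere on [0, T] and equals phi;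
   the default value of derive1 elsewhere is immaterial. *)
Definition I_pow m (D : dynamics R m) (mu : 'cV[R]_m) (g : R -> 'cV[R]_m) :
    \bar R :=
  (\sum_(i < m) (2^-1)%:E * \int[leb]_(t in `[0%R, T])
    ((((derive1 (fun s : R => g s i 0) t - drift D mu i (g t i 0))
        / diffusion D mu i (g t i 0)) ^+ 2)%R%:E))%E.

(* For continuous f the supremum over [0, T] is a maximum. *)
Definition supnorm n (f : R -> 'cV[R]_n) : \bar R :=
  ereal_sup [set (\big[Num.max/0]_(l < n) `|f t l 0|)%:E | t in `[0, T]].

Definition xi n (tau : 'I_n -> R) (nu : 'cV[R]_n) (f : R -> 'cV[R]_n) :
    R -> 'cV[R]_n :=
  fun t => \col_l
    if tau l == 0 then f t l 0 ^+ 2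
    else nu l 0 ^+ 2 * expR (- (t / tau l))
         + (tau l)^-1 * \int[leb]_(s in `[0, t])
             (expR (- ((t - s) / tau l)) * f s l 0 ^+ 2).

End Paths.

Section DecayRates.
Variables (R : realType) (m d : nat) (G : network R (m + d)).
Variables (D : dynamics R m) (T : R).
Local Notation L := #|lines G|.

Definition current (mubar : 'cV[R]_(m + d)) (g : R -> 'cV[R]_m) :
    R -> 'cV[R]_L :=
  fun t => yvec G mubar + C_mx G *m g t.

Definition I_cur (mubar : 'cV[R]_(m + d)) : \bar R :=
  ereal_inf [set I_pow T D (usubmx mubar) g | g in
    [set g | H1 T (usubmx mubar) g /\
             (1 <= supnorm T (current mubar g))%E]].

Definition I_tmp (tau : 'I_L -> R) (mubar : 'cV[R]_(m + d)) : \bar R :=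
  ereal_inf [set I_pow T D (usubmx mubar) g | g in
    [set g | H1 T (usubmx mubar) g /\
             (1 <= supnorm T (xi tau (nuvec G mubar) (current mubar g)))%E]].

Definition psi (mubar : 'cV[R]_(m + d)) (l : 'I_L) (a : R) : \bar R :=
  ereal_inf [set I_pow T D (usubmx mubar) g | g in
    [set g | H1 T (usubmx mubar) g /\ current mubar g T l 0 = a]].

Definition alpha (tau : 'I_L -> R) (mubar : 'cV[R]_(m + d)) (l : 'I_L) : R :=
  let e := if tau l == 0 then 0 else expR (- (T / tau l)) in
  Num.sqrt ((1 - nuvec G mubar l 0 ^+ 2 * e) / (1 - e)).

Definition I_LB (tau : 'I_L -> R) (mubar : 'cV[R]_(m + d)) : \bar R :=
  \big[Order.min/+oo%E]_(l in stochastic_lines G)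
    Order.min (psi mubar l (alpha tau mubar l))
              (psi mubar l (- alpha tau mubar l)).

Definition region (rate : 'cV[R]_(m + d) -> \bar R) (eps p : R) :
    set 'cV[R]_(m + d) :=
  [set mubar | admissible G mubar /\ ((- eps * ln p)%:E <= rate mubar)%E].

Definition region_cur := region I_cur.
Definition region_LB (tau : 'I_L -> R) := region (I_LB tau).
Definition region_tmp (tau : 'I_L -> R) := region (I_tmp tau).

End DecayRates.

(* Main.v *)
Require Import Defs.
From HB Require Import structures.
From mathcomp Require Import all_boot all_order all_algebra.
From mathcomp Require Import all_classical all_reals all_analysis.
From mathcomp Require Import measurable_realfun lra ring.
Set Implicit Arguments.
Unset Strict Implicit.
Unset Printing Implicit Defensive.
Import Order.TTheory GRing.Theory Num.Theory.
Import numFieldNormedType.Exports.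
Local Open Scope classical_set_scope.
Local Open Scope ring_scope.

(* Current rate <= lower bound: 1 <= alpha_l, so a path that brings the current
   of line l to +-alpha_l at time T overloads that line.
   Lower bound <= temperature rate: put e = exp(-T / tau_l). If |f_l| <= M on
   [0, T] with |nu_l| <= M, then the temperature of l stays below
   nu_l^2 e + M^2 (1 - e), and alpha_l is the value of M that makes this
   equal to 1. Hence a path that overheats some line has |f_l(s)| >= alpha_l for
   some l and s, and by the intermediate value theorem f_l hits alpha_l or
   -alpha_l. Waiting at mu for a time T - s and then following the path moves
   this hitting time to T, at no extra cost because the drift vanishes at mu. *)

(** * Translation invariance of Lebesgue measure and integral *)

Section Translation.
Context {R : realType}.
Local Notation leb := (@lebesgue_measure R).
Implicit Types (f g : R -> \bar R) (h : R).

Lemma measurable_translation h :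
  measurable_fun [set: measurableTypeR R] (fun x => x + h : measurableTypeR R).
Proof.
apply: continuous_measurable_fun => x.
by apply: continuousD; [exact: cvg_id | exact: cvg_cst].
Qed.

(** Uniqueness of Lebesgue measure: the pushforward under the translation gives half-open intervals
    their length. *)
Lemma lebesgue_measure_translation h (A : set (measurableTypeR R)) :
  measurable A -> leb ((fun x => x + h) @^-1` A) = leb A.
Proof.
move=> mA; pose s (x : measurableTypeR R) : measurableTypeR R := x + h.
have ms : measurable_fun [set: measurableTypeR R] s.
  exact: measurable_translation.
rewrite [RHS](@lebesgue_measure_unique _ (pushforward leb s))//.
move=> _ [[a b] _ <-] /=.
rewrite /pushforward (_ : s @^-1` _ = `]a - h, b - h]%classic); last first.
  by apply/seteqP; split => x /=; rewrite !in_itv/= ltrBlDr lerBrDr.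
rewrite !lebesgue_measure_itv/= !lte_fin ltrD2r.
by case: ifP => // _; rewrite -!EFinB; congr (_%:E); ring.
Qed.

Import HBNNSimple.

(* The integral of a nonnegative function, measurable or not, is a supremum over
   the simple functions below it, and translations act on these. *)
Lemma le_ge0_integralT f g : (forall x, 0 <= f x)%E ->
  (forall x, f x <= g x)%E -> (\int[leb]_x f x <= \int[leb]_x g x)%E.
Proof.
move=> f0 fg; have g0 x : (0 <= g x)%E by exact: le_trans (fg x).
rewrite !ge0_integralTE//; apply: ereal_sup_le.
move=> _ [k /= kf <-]; exists k => // x; exact: le_trans (kf x) (fg x).
Qed.

Lemma ge0_integral_translation_le h f : (forall x, 0 <= f x)%E ->
  (\int[leb]_x f (x + h)%R <= \int[leb]_x f x)%E.
Proof.
move=> f0; rewrite !ge0_integralTE//.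
apply: ge_ereal_sup => _ [k /= kf <-].
(* Shifting [k] back by [h] turns a simple function below the translate of [f] into one below [f],
   with the same integral. *)
pose kh (x : measurableTypeR R) := k (x - h).
have mkh : measurable_fun setT kh.
  exact: (measurableT_comp _ (measurable_translation (- h))).
have fkh : finite_set (range kh).
  by apply: sub_finite_set (fimfunP k) => _ [x _ <-]; exists (x - h).
have kh0 x : 0 <= kh x by [].
pose q : {nnsfun measurableTypeR R >-> R} :=
  HB.pack kh (isMeasurableFun.Build _ _ _ _ kh mkh)
    (FiniteImage.Build _ _ kh fkh) (isNonNegFun.Build _ _ kh kh0).
apply: ereal_sup_ubound; exists q => /=.
  by move=> x; apply: le_trans (kf _) _; rewrite subrK.
rewrite !sintegralET; apply: eq_fsbigr => r _; congr (_ * _)%E.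
by rewrite -[RHS](lebesgue_measure_translation (- h)).
Qed.

(** The converse inequality is the previous one for the translate of [f] and the shift [- h]. In
    this generality it applies directly to the integrand of [I_pow], which contains [derive1] of a
    path. *)
Lemma ge0_integral_translation h f : (forall x, 0 <= f x)%E ->
  (\int[leb]_x f (x + h)%R = \int[leb]_x f x)%E.
Proof.
move=> f0; apply/eqP; rewrite eq_le ge0_integral_translation_le//=.
have := @ge0_integral_translation_le (- h) (fun x => f (x + h)) (fun x => f0 _).
by under eq_integral do rewrite subrK.
Qed.

Lemma integral_translation h f :
  (\int[leb]_x f (x + h)%R = \int[leb]_x f x)%E.
Proof.
rewrite integralE [RHS]integralE.
rewrite -(ge0_integral_translation h (funepos_ge0 f)).
rewrite -(ge0_integral_translation h (funeneg_ge0 f)).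
by congr (_ - _)%E; apply: eq_integral => x _;
  rewrite (funepos_comp, funeneg_comp).
Qed.
End Translation.

(** * Derivatives of shifted and one-sidedly constant functions *)

Section Derive1.
Context {R : realType}.
Implicit Types (f g : R -> R) (a c h x : R).

Lemma near_eq_derive1 f g x : (\near x, f x = g x) -> derive1 f x = derive1 g x.
Proof. by move=> fg; rewrite !derive1E; exact: near_eq_derive. Qed.

Lemma derive1_translation f h x :
  derive1 (fun t => f (t - h)) x = derive1 f (x - h).
Proof. by rewrite /derive1; under eq_fun do rewrite -addrA. Qed.

(* If f is not derivable at a, then derive1 f a is the default limit, 0. *)
Lemma derive1_eq0_left_cst f a c : (forall x, x <= a -> f x = c) ->
  derive1 f a = 0.
Proof.
move=> fc; rewrite /derive1; set F := (X in X @ _).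
have [cF|dF] := pselect (cvg (F @ 0^')); last exact: dvgP dF.
rewrite cvg_at_leftE//; apply: cvg_lim => //.
apply: cvg_near_cst; near=> t.
by rewrite /F !fc ?subrr ?scaler0// gerDr ltW//; near: t; exact: nbhs_left_lt.
Unshelve. all: by end_near. Qed.
End Derive1.

(** * Square-integrable functions: translation, restriction, integrability *)

Section Lfun2.
Context {R : realType}.
Local Notation leb := (@lebesgue_measure R).
Implicit Types (f : measurableTypeR R -> R) (h T : R).

Lemma Lfun2_translation h f : f \in Lfun leb 2%:E ->
  (fun x => f (x + h)) \in Lfun leb 2%:E.
Proof.
rewrite !inE => /andP[/[!inE]/= mf nf]; apply/andP; split; rewrite inE/=.
  exact: (measurableT_comp mf (measurable_translation h)).
move: nf; rewrite /finite_norm unlock.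
by rewrite (integral_translation h (fun x => `|(f x)%:E| `^ 2)%E).
Qed.

Lemma Lfun2_restrict (A : set (measurableTypeR R)) f : measurable A ->
  f \in Lfun leb 2%:E -> f \_ A \in Lfun leb 2%:E.
Proof.
move=> mA; rewrite !inE => /andP[/[!inE]/= mf nf]; apply/andP; split;
  rewrite inE/=.
  by apply: (measurable_restrictT f mA).1; exact: measurable_funTS.
apply: le_lt_trans nf; rewrite unlock gt0_ler_poweR//.
- by rewrite in_itv/= leey integral_ge0// => x _; exact: poweR_ge0.
- by rewrite in_itv/= leey integral_ge0// => x _; exact: poweR_ge0.
apply: le_ge0_integralT => x; first exact: poweR_ge0.
rewrite /= /patch; have [xA|xA] := boolP (x \in A); first by [].
by rewrite lee_fin normr0 powR0 ?powR_ge0 ?pnatr_eq0.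
Qed.

(** On a bounded interval [1 + f ^ 2] is integrable and dominates [|f|]. *)
Lemma L2_integrable T f : L2 T f -> leb.-integrable `[0, T] (EFin \o f).
Proof.
move=> L2f; have := Lfun2_integrable_sqr L2f.
move: L2f; rewrite /L2 !inE => /andP[/[!inE]/= mf _] if2.
have mT : measurable (`[0, T]%classic : set (measurableTypeR R)).
  exact: measurable_itv.
have i1 : leb.-integrable `[0, T] (EFin \o cst (1 : R)).
  apply: continuous_compact_integrable; first exact: segment_compact.
  by apply: continuous_subspaceT => x; exact: cvg_cst.
have iq := integrableS measurableT mT (@subsetT _ _) if2.
apply: (le_integrable mT _ _ (integrableD mT i1 iq)).
- by apply/measurable_EFinP; apply: (measurable_restrictT f mT).2; exact: mf.
- move=> x xT /=; rewrite /= /patch mem_set// lee_fin.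
  rewrite [leRHS]ger0_norm ?addr_ge0 ?sqr_ge0//.
  rewrite -(real_normK (num_real (f x))); have := normr_ge0 (f x).
  by move: `|f x| => y; nra.
Qed.
End Lfun2.

(** * Paths that rest before they move *)

Section Delay.
Context {R : realType}.
Local Notation leb := (@lebesgue_measure R).

(** Polymorphic in [V], to delay a path or its coordinates with resting value [mu], and its
    derivative with resting value [0]. *)
Definition delay (V : Type) (h : R) (v : V) (g : R -> V) : R -> V :=
  fun t => if t <= h then v else g (t - h).

Lemma L2_delay (T h : R) (f : R -> R) : 0 <= h -> L2 T f -> L2 T (delay h 0 f).
Proof.
move=> h0 L2f.
(* Open at [0], since [delay] still takes its resting value at [t = h]. *)
have mI : measurable (`]0, T - h]%classic : set (measurableTypeR R)).
  exact: measurable_itv.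
have := Lfun2_translation (- h) (Lfun2_restrict mI L2f).
rewrite /L2 [X in X \in _ -> _](_ : _ = delay h 0 f \_ `[0, T])//.
apply/funext => t; rewrite /patch /delay !mem_setE !in_itv/=.
rewrite subr_gt0 lerD2r; case: leP => ht /=; first by case: ifP.
rewrite (le_trans h0 (ltW ht))/=; case: ifP => // tT.
by rewrite ifT// subr_ge0 (ltW ht)/= (le_trans _ tT)// gerBl.
Qed.

Lemma Rintegral_delay (T h t : R) (f : R -> R) : 0 <= h -> h < t <= T ->
  L2 T f ->
  \int[leb]_(s in `[0, t]) delay h 0 f s = \int[leb]_(s in `[0, t - h]) f s.
Proof.
move=> h0 /andP[ht tT] L2f.
(* Dropping the null endpoint [0] makes the two integrands exact translates of each other. *)
rewrite -[RHS]Rintegral_itv_obnd_cbnd; last first.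
  apply: (integrableS _ _ _ (L2_integrable L2f)); try exact: measurable_itv.
  move=> x /=; rewrite !in_itv/= => /andP[x0 xth].
  by rewrite ltW// (le_trans xth)// (le_trans _ tT)// gerBl.
rewrite Rintegral_mkcond [RHS]Rintegral_mkcond /Rintegral; congr fine.
pose q s := ((f \_ `]0, t - h]) s)%:E.
transitivity (\int[leb]_s q (s + - h)%R)%E; last first.
  exact: (integral_translation (- h) q).
apply: eq_integral => s _; congr EFin.
rewrite /patch /delay !mem_setE !in_itv/= subr_gt0 lerD2r.
case: (leP s h) => hs; first by case: ifP.
by rewrite (le_trans h0 (ltW hs)).
Qed.

Lemma H1_delay m (T h : R) (mu : 'cV[R]_m) (g : R -> 'cV[R]_m) :
  0 <= h -> H1 T mu g -> H1 T mu (delay h mu g).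
Proof.
move=> h0 [phi [L2phi gE]].
(* The derivative of the delayed path: zero during the rest, then [phi] shifted. *)
exists (delay h 0 phi); have phiE i :
    (fun s => delay h 0 phi s i 0) = delay h 0 (fun s => phi s i 0).
  by apply/funext => s; rewrite /delay; case: ifP => // _; rewrite mxE.
split=> [i|t tT i]; first by rewrite phiE; exact: L2_delay.
rewrite [X in Rintegral _ _ X]phiE {1}/delay; case: leP => [th|ht].
  rewrite (@eq_Rintegral _ _ _ _ _ (cst 0)) ?Rintegral_cst ?mul0r ?addr0//.
  move=> s; rewrite inE/= in_itv/= /delay => /andP[_ st].
  by rewrite (le_trans st th).
move: tT; rewrite in_itv/= => /andP[t0 tT].
rewrite (Rintegral_delay h0 _ (L2phi i)) ?ht// gE// in_itv/=.
by rewrite subr_ge0 ltW//= (le_trans _ tT)// gerBl.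
Qed.

Lemma H1_0 m (T : R) (mu : 'cV[R]_m) (g : R -> 'cV[R]_m) :
  0 <= T -> H1 T mu g -> g 0 = mu.
Proof.
move=> T0 [phi [_ gE]]; apply/colP => i.
by rewrite gE ?in_itv/= ?lexx// set_itv1 Rintegral_set1 addr0.
Qed.

Lemma H1_continuous m (T : R) (mu : 'cV[R]_m) (g : R -> 'cV[R]_m) i :
  0 <= T -> H1 T mu g -> {within `[0, T], continuous (fun t => g t i 0)}.
Proof.
move=> T0 [phi [L2phi gE]].
have pc := parameterized_integral_continuous T0 (L2_integrable (L2phi i)).
apply: (@subspace_eq_continuous _ _ _ (fun t => mu i 0 +
  parameterized_integral leb 0 t (fun s => phi s i 0))).
  by move=> t /set_mem tT; exact/esym/(gE t tT i).
by move=> x; apply: (cvgD (cvg_cst _)); exact: pc.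
Qed.

(* The delayed path pays nothing while it rests at mu, because the drift
   vanishes there. *)
Lemma I_pow_delay m (D : dynamics R m) (T h : R) (mu : 'cV[R]_m)
    (g : R -> 'cV[R]_m) :
  0 <= h -> (I_pow T D mu (delay h mu g) <= I_pow T D mu g)%E.
Proof.
move=> h0; apply: lee_sum => i _; apply: lee_wpmul2l.
  by rewrite lee_fin invr_ge0.
rewrite [leRHS]integral_mkcond [leLHS]integral_mkcond.
(* After this shift the integrands compare pointwise: the left one vanishes up to [h], both agree on
   []h, T]], and beyond [T] only the right one can be positive. *)
rewrite -[leRHS](ge0_integral_translation (- h)); last first.
  by move=> t; apply: erestrict_ge0 => s _; rewrite lee_fin sqr_ge0.
apply: le_ge0_integralT => t.
  by apply: erestrict_ge0 => s _; rewrite lee_fin sqr_ge0.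
have gE : (fun s => delay h mu g s i 0) = delay h (mu i 0) (fun s => g s i 0).
  by apply/funext => s; rewrite /delay; case: ifP.
have ghE : delay h mu g t i 0 = delay h (mu i 0) (fun s => g s i 0) t.
  by rewrite /delay; case: ifP.
rewrite /patch !mem_setE !in_itv/= subr_ge0 gE ghE.
(* At [t = h] the delayed path may fail to be derivable, but [derive1] is still [0] there, by left
   constancy or by its default value. *)
have [th|ht] := leP t h.
  rewrite (@derive1_eq0_left_cst _ _ t (mu i 0)); last first.
    by move=> s st; rewrite /delay (le_trans st th).
  rewrite /delay th drift_init subrr mul0r expr0n/= if_same.
  by case: ifP => // _; rewrite lee_fin sqr_ge0.
rewrite (ltW ht)/= (le_trans h0 (ltW ht))/=.
case: ifP => [tT|_]; last by case: ifP => // _; rewrite lee_fin sqr_ge0.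
rewrite ifT; last by rewrite (le_trans _ tT)// gerBl.
rewrite (@near_eq_derive1 _ _ (fun s => g (s - h) i 0)); last first.
  near=> s; rewrite /delay ifF//; apply/negbTE; rewrite -ltNge.
  by near: s; exact: lt_nbhsr.
rewrite (derive1_translation (fun s => g s i 0)) /delay.
by rewrite ifF// leNgt ht.
Unshelve. all: by end_near. Qed.
End Delay.

(** * Integral of the exponential relaxation kernel *)

Section Relaxation.
Context {R : realType}.
Local Notation leb := (@lebesgue_measure R).
Implicit Types (c t s T : R).

Lemma is_derive_exp_kernel c t s :
  is_derive s (1 : R) (fun s => c * expR (- ((t - s) / c)) : R)
    (c * (expR (- ((t - s) / c)) * c^-1)).
Proof.
have dl : is_derive s (1 : R) (fun s => - ((t - s) / c) : R) c^-1.
  rewrite (_ : (fun s => _) = (cst (- (t / c)) + c^-1 \*: id : R -> R));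
    last first.
    by apply/funext => x; rewrite !fctE/= /GRing.scale/=; ring.
  by apply: is_derive_eq; rewrite add0r /GRing.scale/= mulr1.
have de := @is_derive1_comp _ expR (fun s => - ((t - s) / c)) _ _ _
  (is_derive_expR _) dl.
exact: (is_deriveZ c).
Qed.

Lemma continuous_exp_kernel c t :
  continuous (fun s => expR (- ((t - s) / c)) : R).
Proof.
move=> s; apply: (@continuous_comp _ _ _ (fun s => - ((t - s) / c)) expR).
  apply: cvgN; apply: cvgM; last exact: cvg_cst.
  by apply: cvgB; [exact: cvg_cst | exact: cvg_id].
exact: continuous_expR.
Qed.

Lemma Rintegral_exp_kernel c t : c != 0 -> 0 <= t ->
  \int[leb]_(s in `[0, t]) expR (- ((t - s) / c)) = c * (1 - expR (- (t / c))).
Proof.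
(* The fundamental theorem of calculus is applied on a nondegenerate interval, so [t = 0] is split
   off. *)
move=> c0; rewrite le_eqVlt => /predU1P[<-|t0].
  by rewrite set_itv1 Rintegral_set1 mul0r oppr0 expR0 subrr mulr0.
have dF (s : R) := is_derive_exp_kernel c t s.
rewrite /Rintegral (@continuous_FTC2 _ _
  (fun s => c * expR (- ((t - s) / c))))//.
- by rewrite /= subrr mul0r oppr0 expR0 addr0 mulrBr.
- exact/continuous_subspaceT/continuous_exp_kernel.
- have cF : continuous (fun s => c * expR (- ((t - s) / c)) : R).
    by move=> s; apply: cvgM; [exact: cvg_cst | exact: continuous_exp_kernel].
  split; [by move=> s _; case: (dF s)|
    exact/cvg_at_right_filter/cF|exact/cvg_at_left_filter/cF].
- move=> s _; rewrite derive1E (@derive_val _ _ _ _ _ _ _ (dF s)).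
  by rewrite mulrCA divff ?mulr1.
Qed.
End Relaxation.

(** * Bounding the temperature by the maximal current *)

Section Temperature.
Context {R : realType}.
Local Notation leb := (@lebesgue_measure R).
Variables (n : nat) (tau : 'I_n -> R) (nu : 'cV[R]_n) (f : R -> 'cV[R]_n).
Variables (T : R) (l : 'I_n).
Hypotheses (T_gt0 : 0 < T) (tau_ge0 : 0 <= tau l).

(** The weight the initial temperature retains at time [T], with the convention of [alpha] at
    [tau = 0]; it treats both cases of [xi] uniformly. *)
Definition decay (tau T : R) : R := if tau == 0 then 0 else expR (- (T / tau)).

Lemma decay_ge0 c t : 0 <= decay c t.
Proof. by rewrite /decay; case: ifP => // _; exact: expR_ge0. Qed.

Lemma decay_lt1 : decay (tau l) T < 1.
Proof.
rewrite /decay; case: eqVneq => // c0.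
by rewrite -expR0 ltr_expR oppr_lt0 divr_gt0// lt0r c0.
Qed.

Lemma decay_le t : t <= T -> decay (tau l) T <= decay (tau l) t.
Proof.
move=> tT; rewrite /decay; case: eqVneq => // c0.
by rewrite ler_expR lerN2 ler_wpM2r// invr_ge0.
Qed.

Lemma xi_ge0 t : 0 <= xi tau nu f t l 0.
Proof.
rewrite mxE; case: ifP => _; first exact: sqr_ge0.
apply: addr_ge0; first by rewrite mulr_ge0 ?sqr_ge0 ?expR_ge0.
apply: mulr_ge0; first by rewrite invr_ge0.
by apply: Rintegral_ge0 => s _; rewrite mulr_ge0 ?sqr_ge0 ?expR_ge0.
Qed.

Hypothesis f_cont : {within `[0, T], continuous (fun t => f t l 0)}.

(** At time [t] the bound puts weight [decay t] on [nu ^ 2] and the rest on [M ^ 2]. As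
    [nu ^ 2 <= M ^ 2] and [decay] is nonincreasing in time, it is largest at [T]. *)
Lemma xi_le (M t : R) : nu l 0 ^+ 2 <= M ^+ 2 ->
  (forall s, s \in `[0, T] -> `|f s l 0| <= M) -> t \in `[0, T] ->
  xi tau nu f t l 0 <=
    nu l 0 ^+ 2 * decay (tau l) T + M ^+ 2 * (1 - decay (tau l) T).
Proof.
move=> nuM fM tT; have fM2 s : s \in `[0, T] -> f s l 0 ^+ 2 <= M ^+ 2.
  move=> sT; rewrite -(real_normK (num_real (f s l 0))).
  by rewrite lerXn2r ?nnegrE ?fM ?(le_trans _ (fM s sT)).
apply: (@le_trans _ _ (nu l 0 ^+ 2 * decay (tau l) t +
    M ^+ 2 * (1 - decay (tau l) t))); last first.
  have eT : decay (tau l) T <= decay (tau l) t.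
    by apply: decay_le; rewrite (itvP tT).
  by rewrite -subr_ge0; nra.
rewrite mxE /decay; case: eqVneq => [_|c0].
  by rewrite mulr0 add0r subr0 mulr1 fM2.
rewrite lerD2l ler_pdivrMl ?lt0r ?c0//.
move: tT; rewrite in_itv/= => /andP[t0 tT].
have sub : `[0, t] `<=` `[0, T] by apply: subset_itvl; rewrite bnd_simp.
have ck := continuous_subspaceT (@continuous_exp_kernel R (tau l) t)
  (A := `[0, t]).
(* [M ^ 2] times the mass of the kernel is written as an integral, so that integrands can be
   compared pointwise. *)
rewrite [leRHS](_ : _ = \int[leb]_(s in `[0, t])
    (expR (- ((t - s) / tau l)) * M ^+ 2)); last first.
  rewrite RintegralZr//; last first.
    by apply: continuous_compact_integrable => //; exact: segment_compact.
  by rewrite Rintegral_exp_kernel//; ring.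
apply: le_Rintegral => //.
- apply: continuous_compact_integrable; first exact: segment_compact.
  move=> s; apply: cvgM; first exact: ck.
  have cf := continuous_subspaceW sub f_cont.
  by apply: (cvgM (cf s) (cf s)).
- apply: continuous_compact_integrable; first exact: segment_compact.
  by move=> s; apply: cvgM; [exact: ck | exact: cvg_cst].
- by move=> s /sub sT; rewrite ler_wpM2l ?expR_ge0// fM2.
Qed.

End Temperature.

(** * Comparison of the three decay rates *)

Section Rates.
Variables (R : realType) (m d : nat) (G : network R (m + d)).
Variables (D : dynamics R m) (T : R).
Hypothesis T_gt0 : 0 < T.
Local Notation L := #|lines G|.
Variables (tau : 'I_L -> R) (mubar : 'cV[R]_(m + d)).
Hypothesis tau_ge0 : forall l, 0 <= tau l.
Hypothesis mubar_adm : admissible G mubar.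
Local Notation mu := (usubmx mubar).
Local Notation nu := (nuvec G mubar).
Implicit Types (g : R -> 'cV[R]_m) (l : 'I_L) (s t a : R).

Lemma sqr_nu_le1 l : nu l 0 ^+ 2 <= 1.
Proof.
by rewrite -(real_normK (num_real _)) expr_le1// (mubar_adm.1 l).
Qed.

Lemma sqr_alpha l :
  alpha T tau mubar l ^+ 2 * (1 - decay (tau l) T) =
  1 - nu l 0 ^+ 2 * decay (tau l) T.
Proof.
have e1 := decay_lt1 T_gt0 (tau_ge0 l); have e0 := decay_ge0 (tau l) T.
rewrite /alpha /= -/(decay (tau l) T) sqr_sqrtr ?divfK ?gt_eqF ?subr_gt0//.
by rewrite divr_ge0 ?subr_ge0 ?ltW//; have := sqr_nu_le1 l; nra.
Qed.

(** As [nu ^ 2 <= 1], the numerator under the root is at least the denominator. *)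
Lemma alpha_ge1 l : 1 <= alpha T tau mubar l.
Proof.
have e1 := decay_lt1 T_gt0 (tau_ge0 l); have e0 := decay_ge0 (tau l) T.
rewrite /alpha /= -/(decay (tau l) T) -[leLHS]sqrtr1 ler_wsqrtr//.
by rewrite ler_pdivlMr ?subr_gt0// mul1r; have := sqr_nu_le1 l; nra.
Qed.

Lemma currentE g t l :
  current G mubar g t l 0 = yvec G mubar l 0 + \sum_j C_mx G l j * g t j 0.
Proof. by rewrite !mxE. Qed.

Lemma current_continuous g l : H1 T mu g ->
  {within `[0, T], continuous (fun t => current G mubar g t l 0)}.
Proof.
move=> Hg; rewrite (funext (fun t => currentE g t l)).
move=> t; apply: cvgD; first exact: cvg_cst.
apply: cvg_big => [|j _]; first exact: add_continuous.
exact: (cvgM (cvg_cst _) (@H1_continuous _ _ _ _ _ j (ltW T_gt0) Hg t)).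
Qed.

Lemma current0 g : H1 T mu g -> current G mubar g 0 = nu.
Proof. by move=> Hg; rewrite /current (H1_0 (ltW T_gt0) Hg) addrC. Qed.

Lemma current_delay g h : 0 <= h <= T -> H1 T mu g ->
  current G mubar (delay h mu g) T = current G mubar g (T - h).
Proof.
move=> /andP[h0 hT] Hg; rewrite /current /delay; case: leP => // Th.
(* Boundary case: the path rests during all of [[0, T]], and both sides are the current at [mu]. *)
have -> : h = T by apply/le_anti; rewrite hT.
by rewrite subrr (H1_0 (ltW T_gt0) Hg).
Qed.

(** A zero row of [C_mx] freezes the current. Such a line stays strictly below 1 in modulus, so a
    line that reaches [alpha] must be stochastic. *)
Lemma current_deterministic g t l : l \notin stochastic_lines G ->
  current G mubar g t l 0 = nu l 0.
Proof.
rewrite inE negbK => /eqP/rowP Cl0.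
have Cv0 (v : 'cV[R]_m) : (C_mx G *m v) l 0 = 0.
  rewrite mxE big1// => j _; have := Cl0 j.
  by rewrite !mxE => ->; rewrite mul0r.
by rewrite [LHS]mxE [RHS]mxE !Cv0 addr0 add0r.
Qed.

(* Waiting at mu costs nothing, so a value reached at an intermediate time can
   be reached at time T at no greater cost. *)
Lemma psi_le g s l : H1 T mu g -> s \in `[0, T] ->
  (psi D T mubar l (current G mubar g s l 0)%R <= I_pow T D mu g)%E.
Proof.
move=> Hg; rewrite in_itv/= => /andP[s0 sT].
apply: le_trans (I_pow_delay D T mu g (_ : 0 <= T - s)); last first.
  by rewrite subr_ge0.
apply: ereal_inf_lbound; exists (delay (T - s) mu g) => //; split.
  by apply: H1_delay => //; rewrite subr_ge0.
by rewrite current_delay// ?subKr// subr_ge0 sT gerBl.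
Qed.

(** Strictness survives the supremum because each current attains its maximal modulus [M] on
    [[0, T]]: then [M < alpha], and the bound of [xi_le], equal to 1 at [M = alpha], stays below
    1. *)
Lemma supnorm_xi_lt1 g : H1 T mu g ->
  (forall l s, s \in `[0, T] ->
    `|current G mubar g s l 0| < alpha T tau mubar l) ->
  (supnorm T (xi tau nu (current G mubar g)) < 1)%E.
Proof.
move=> Hg fa.
have bnd l : exists2 c, c < 1 & forall t, t \in `[0, T] ->
    `|xi tau nu (current G mubar g) t l 0| <= c.
  have fc := @current_continuous g l Hg.
  have [t0 t0T fM] : exists2 c, c \in `[0, T] & forall t, t \in `[0, T] ->
      `|current G mubar g t l 0| <= `|current G mubar g c l 0|.
    apply: (@EVT_max _ (fun t => `|current G mubar g t l 0|)); first exact: ltW.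
    by move=> t; apply: cvg_norm; exact: fc.
  set M := `|current G mubar g t0 l 0| in fM.
  have Ma : M < alpha T tau mubar l by exact: fa.
  (* [nu] is the current at time [0], hence bounded by the maximum. *)
  have nuM : nu l 0 ^+ 2 <= M ^+ 2.
    rewrite -(real_normK (num_real (nu l 0))) lerXn2r ?nnegrE ?normr_ge0//.
    by rewrite -(current0 Hg) fM// in_itv/= lexx ltW.
  have Ma2 : M ^+ 2 < alpha T tau mubar l ^+ 2.
    by rewrite ltrXn2r ?nnegrE ?normr_ge0// (le_trans _ (ltW Ma)) ?normr_ge0.
  exists (nu l 0 ^+ 2 * decay (tau l) T + M ^+ 2 * (1 - decay (tau l) T)).
    have e1 : 0 < 1 - decay (tau l) T by rewrite subr_gt0 decay_lt1.
    by rewrite -ltrBrDl -sqr_alpha ltr_pM2r.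
  by move=> t tT; rewrite ger0_norm ?xi_ge0//; exact: xi_le.
have [c c1 xic] : exists2 c : 'I_L -> R, (forall l, c l < 1) &
    forall l t, t \in `[0, T] -> `|xi tau nu (current G mubar g) t l 0| <= c l.
  have /(_ _) /cid2-/all_sig2[c c1 xic] := bnd.
  by exists c.
(* Finitely many bounds below 1, with base value [0], give one bound below 1 for all lines and
   times. *)
apply: (@le_lt_trans _ _ (\big[Order.max/0]_l c l)%:E); last first.
  by rewrite lte_fin; apply: bigmax_lt.
apply: ge_ereal_sup => _ [t tT <-]; rewrite lee_fin.
by apply: le_bigmax2 => l _; exact: xic.
Qed.

Lemma I_LB_le_I_pow g : H1 T mu g ->
  (1 <= supnorm T (xi tau nu (current G mubar g)))%E ->
  (I_LB D T tau mubar <= I_pow T D mu g)%E.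
Proof.
move=> Hg xi1.
have [l [s sT als]] : exists l, exists2 s, s \in `[0, T] &
    alpha T tau mubar l <= `|current G mubar g s l 0|.
  apply: contrapT => /forallNP nals; move: xi1; rewrite leNgt => /negP; apply.
  apply: supnorm_xi_lt1 => // l s sT; rewrite ltNge; apply/negP => als.
  by apply: (nals l); exists s.
have a1 := alpha_ge1 l.
have lS : l \in stochastic_lines G.
  apply: contraPT als => lS; rewrite current_deterministic//; apply/negP.
  by rewrite -ltNge (lt_le_trans _ a1)// mubar_adm.2.
have s0 : 0 <= s by rewrite (itvP sT).
have sub : `[0, s] `<=` `[0, T].
  by apply: subset_itvl; rewrite bnd_simp (itvP sT).
have fc := continuous_subspaceW sub (@current_continuous g l Hg).
have := mubar_adm.1 l; rewrite -(current0 Hg) ler_norml => /andP[nu0 nu1].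
(* Since [|nu| <= 1 <= alpha], a current at or beyond [alpha] or [- alpha] at time [s] traps that
   level between its values at [0] and [s]; min and max cover both signs. *)
have hit a : Num.min (current G mubar g 0 l 0) (current G mubar g s l 0) <= a <=
             Num.max (current G mubar g 0 l 0) (current G mubar g s l 0) ->
    (psi D T mubar l a <= I_pow T D mu g)%E.
  by move=> /(IVT s0 fc)[c /sub cT <-]; exact: psi_le.
apply: le_trans (bigmin_le_cond _ _ lS) _ => /=; rewrite ge_min.
move: als; rewrite ler_normr => /orP[als|als]; apply/orP; [left|right];
  apply: hit.
  by rewrite ge_min le_max als (le_trans nu1 a1) orbT.
by rewrite ge_min le_max; apply/andP; split; apply/orP; [right|left]; lra.
Qed.

Lemma I_cur_le_I_LB : (I_cur G D T mubar <= I_LB D T tau mubar)%E.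
Proof.
(* Every path competing in [psi] at such a level also competes in [I_cur], with time [T] as witness
   of the overload. *)
have cur a l : 1 <= `|a| -> (I_cur G D T mubar <= psi D T mubar l a)%E.
  move=> a1; apply: ereal_inf_le_tmp => _ [g [Hg gTa] <-].
  exists g => //; split=> //; apply: le_ereal_sup_tmp.
  exists (\big[Order.max/0]_k `|current G mubar g T k 0|)%:E.
    by exists T => //=; rewrite in_itv/= lexx ltW.
  rewrite lee_fin; apply: le_trans a1 _; rewrite -gTa.
  exact: (le_bigmax _ (fun k => `|current G mubar g T k 0|)).
apply: le_bigmin; first exact: leey.
move=> l _; have a1 : 1 <= `|alpha T tau mubar l|.
  by rewrite (le_trans (alpha_ge1 l))// ler_norm.
by rewrite le_min !cur// normrN.
Qed.

Lemma I_LB_le_I_tmp : (I_LB D T tau mubar <= I_tmp D T tau mubar)%E.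
Proof.
by apply: le_ereal_inf_tmp => _ [g [Hg xi1] <-]; exact: I_LB_le_I_pow.
Qed.

End Rates.

Theorem mainTheorem7 (R : realType) (m d : nat) (m_gt0 : (0 < m)%N)
    (G : network R (m + d)) (D : dynamics R m) (T : R) (T_gt0 : 0 < T) :
  (forall tau : 'I_#|lines G| -> R, (forall l, 0 <= tau l) ->
     forall mubar : 'cV[R]_(m + d), admissible G mubar ->
       (I_cur G D T mubar <= I_LB D T tau mubar)%E /\
       (I_LB D T tau mubar <= I_tmp D T tau mubar)%E)
  /\
  (forall eps p : R, 0 < eps -> 0 < p < 1 ->
     forall tau : 'I_#|lines G| -> R, (forall l, 0 <= tau l) ->
       region_cur G D T eps p `<=` region_LB D T tau eps p /\
       region_LB D T tau eps p `<=` region_tmp D T tau eps p).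
Proof.
split=> [tau tau0 mubar adm|eps p _ _ tau tau0].
  by split; [exact: I_cur_le_I_LB | exact: I_LB_le_I_tmp].
split=> mubar [adm le_rate]; split=> //; apply: le_trans le_rate _.
  exact: I_cur_le_I_LB.
exact: I_LB_le_I_tmp.
Qed.
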